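(* Let $X$ be a sequentially ASQ real Banach space and let $\mathcal U$ be a selective ultrafilter over $\mathbb N$. Then there exists $h\in S_{X^{****}}$ such that $$\Vert x+h\Vert=\max\{\Vert x\Vert,1\}$$ holds for all $x\in X$.
   Context: All Banach spaces are real. $X^{****}$ is the fourth dual of $X$, with $X$ canonically embedded in it, and $S_{Y}$ denotes the unit sphere of a Banach space $Y$. A Banach space $X$ is sequentially ASQ (sequentially almost square) if there exists a sequence $(x_n)$ in $S_X$ such that $\Vert x+x_n\Vert\to\max\{\Vert x\Vert,1\}$ for every $x\in X$. A nonprincipal ultrafilter $\mathcal U$ over $\mathbb N$ is selective (also called Ramsey) if for every partition $\mathbb N=\bigcup_n A_n$ into sets $A_n\notin\mathcal U$ there exists a set in $\mathcal U$ that meets each set of the partition at exactly one point. *)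

(* Defs.v *)
From HB Require Import structures.
From mathcomp Require Import all_boot all_order all_algebra.
From mathcomp Require Import all_classical all_reals all_analysis.

Set Implicit Arguments.
Unset Strict Implicit.
Unset Printing Implicit Defensive.

Import Order.TTheory GRing.Theory Num.Theory.
Import numFieldNormedType.Exports.

Local Open Scope classical_set_scope.
Local Open Scope ring_scope.

Section DualSpace.
Variables (R : realType) (X : normedModType R).

Definition continuous_linear_form : {pred X -> R} :=
  mem [set f : X -> R | linear f /\ continuous f].

Record dual_space := DualSpace {
  dual_fun :> X -> R;
  dual_funP : dual_fun \in continuous_linear_form
}.

HB.instance Definition _ := [isSub for dual_fun].
HB.instance Definition _ := [Choice of dual_space by <:].

Lemma continuous_linear_form_submod_closed :
  submod_closed continuous_linear_form.
Proof.
split.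
  by rewrite inE; split=> [a x y|x]; [rewrite scaler0 addr0|exact: cvg_cst].
move=> a f g /set_mem[fl fc] /set_mem[gl gc]; rewrite inE; split.
  move=> b x y; rewrite !fctE fl gl !scalerDr !scalerA (mulrC a).
  by rewrite addrACA.
move=> x; apply: cvgD; last exact: gc.
by apply: cvgZl_tmp; exact: fc.
Qed.

HB.instance Definition _ := GRing.isSubmodClosed.Build _ _
  continuous_linear_form continuous_linear_form_submod_closed.
HB.instance Definition _ := [SubChoice_isSubLmodule of dual_space by <:].

Lemma dual_fun_linear (f : dual_space) : linear f.
Proof. by have /set_mem[] := dual_funP f. Qed.

HB.instance Definition _ (f : dual_space) :=
  GRing.isLinear.Build R X R _ (dual_fun f) (dual_fun_linear f).

Lemma dual_fun_continuous (f : dual_space) : continuous f.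
Proof. by have /set_mem[] := dual_funP f. Qed.

Lemma dual_addE (f g : dual_space) x : (f + g) x = f x + g x.
Proof. by []. Qed.

Lemma dual_scaleE (a : R) (f : dual_space) x : (a *: f) x = a * f x.
Proof. by []. Qed.

Lemma dual_zeroE x : (0 : dual_space) x = 0.
Proof. by []. Qed.

Definition dual_norm (f : dual_space) : R :=
  sup [set `|f x| | x in [set x : X | `|x| <= 1]].

Lemma dual_norm_has_sup (f : dual_space) :
  has_sup [set `|f x| | x in [set x : X | `|x| <= 1]].
Proof.
split; first by exists `|f 0|, 0 => //=; rewrite normr0.
have /linear_boundedP/pinfty_ex_gt0[r r0 fr] :
    bounded_near f (nbhs (0 : X)).
  by apply: continuous_linear_bounded; exact: dual_fun_continuous.
exists r => _ [x /= x1 <-]; rewrite (le_trans (fr x))//.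
by rewrite ler_piMr// ltW.
Qed.

Lemma dual_norm_ub (f : dual_space) x : `|x| <= 1 -> `|f x| <= dual_norm f.
Proof.
move=> x1; have [_ fub] := dual_norm_has_sup f.
by apply: (ub_le_sup fub); exists x.
Qed.

Lemma dual_norm_le (f : dual_space) c :
  (forall x, `|x| <= 1 -> `|f x| <= c) -> dual_norm f <= c.
Proof.
move=> fc; have [f0 _] := dual_norm_has_sup f.
by apply: ge_sup => // _ [x /= x1 <-]; exact: fc.
Qed.

Lemma dual_norm_ge0 f : 0 <= dual_norm f.
Proof. by rewrite (le_trans _ (@dual_norm_ub f 0 _)) ?normr0. Qed.

Lemma dual_normP (f : dual_space) x : `|f x| <= dual_norm f * `|x|.
Proof.
have [->|x0] := eqVneq x 0; first by rewrite linear0 !normr0 mulr0.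
have nx0 : 0 < `|x| by rewrite normr_gt0.
rewrite -ler_pdivrMr// mulrC.
have := @dual_norm_ub f (`|x|^-1 *: x).
rewrite linearZ/= !normrZ normfV normr_id mulVf ?gt_eqF// => h.
by apply: h.
Qed.

Lemma dual_norm_triangle f g : dual_norm (f + g) <= dual_norm f + dual_norm g.
Proof.
apply: dual_norm_le => x x1; rewrite dual_addE (le_trans (ler_normD _ _))//.
by rewrite lerD// dual_norm_ub.
Qed.

Lemma dual_normZ a f : dual_norm (a *: f) = `|a| * dual_norm f.
Proof.
have le b g : dual_norm (b *: g) <= `|b| * dual_norm g.
  apply: dual_norm_le => x x1; rewrite dual_scaleE normrM.
  by rewrite ler_wpM2l// dual_norm_ub.
apply/eqP; rewrite eq_le le/=.
have [->|a0] := eqVneq a 0; first by rewrite normr0 mul0r dual_norm_ge0.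
rewrite -ler_pdivlMl ?normr_gt0// -normfV.
by rewrite (le_trans _ (le _ _))// scalerA mulVf// scale1r.
Qed.

Lemma dual_norm0_eq0 f : dual_norm f = 0 -> f = 0.
Proof.
move=> f0; apply: val_inj; apply/funext => x /=.
by apply/normr0_eq0/le_anti; rewrite normr_ge0 (le_trans (dual_normP f x)) ?f0 ?mul0r.
Qed.

HB.instance Definition _ := Lmodule_isNormed.Build R dual_space
  dual_norm_triangle dual_normZ dual_norm0_eq0.

End DualSpace.

Section CanonicalEmbedding.
Variables (R : realType) (X : normedModType R).

Lemma evaluation_continuous_linear (x : X) :
  (fun f : dual_space X => f x) \in @continuous_linear_form R (dual_space X).
Proof.
rewrite inE.
have L : linear (fun f : dual_space X => f x) by [].
split=> //.
pose e : {linear dual_space X -> R} :=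
  HB.pack (fun f : dual_space X => f x)
    (GRing.isLinear.Build R (dual_space X) R _ _ L).
apply: (@bounded_linear_continuous _ _ _ e); apply/linear_boundedP.
exists `|x|; split=> [|r xr f /=]; first exact: num_real.
rewrite (le_trans (dual_normP f x))// mulrC.
by apply: ler_wpM2r; [exact: dual_norm_ge0|exact: ltW].
Qed.

Definition bidual_embedding (x : X) : dual_space (dual_space X) :=
  DualSpace (evaluation_continuous_linear x).

End CanonicalEmbedding.

Notation fourth_dual X := (dual_space (dual_space (dual_space (dual_space X)))).

(* $X \to X^{**} \to X^{****}$ through the evaluation maps of $X$ and of
   $X^{**}$; by naturality, using the second adjoint of the former as the
   second map would give the same embedding. *)
Definition fourth_dual_embedding (R : realType) (X : normedModType R) (x : X)
  : fourth_dual X := bidual_embedding (bidual_embedding x).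

Definition sequentially_ASQ (R : realType) (X : normedModType R) : Prop :=
  exists2 u : nat -> X, (forall n, `|u n| = 1) &
    forall x : X, `|x + u n| @[n --> \oo] --> Num.max `|x| 1.

(* [partition] requires nonempty blocks. Indexing by all of [nat] loses
   nothing: a finite partition always has a block in the ultrafilter. *)
Definition selective_ultrafilter (U : set_system nat) : Prop :=
  [/\ UltraFilter U,
      forall n, U <> principal_filter n &
      forall A : nat -> set nat,
        partition setT A setT -> (forall n, ~ U (A n)) ->
        exists2 S : set nat, U S & forall n, exists k, S `&` A n = [set k]].

(* Main.v *)
Require Import Defs.
From HB Require Import structures.
From mathcomp Require Import all_boot all_order all_algebra.
From mathcomp Require Import all_classical all_reals all_analysis.
From mathcomp Require Import ring lra zify.

Import Order.TTheory GRing.Theory Num.Theory.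
Import numFieldNormedType.Exports.

Local Open Scope classical_set_scope.
Local Open Scope ring_scope.

(** Let [u] witness that [X] is sequentially almost square. For a fixed [x] and
    [e > 0], a set [A] of indices that is sparse enough (how sparse depends on
    [x] and [e]) satisfies
      [`|x + \sum_(i in B) (+/-) u i| <= max(`|x|, 1) + e]
    for every finite [B] inside [A] and every choice of signs: each new term
    enlarges the norm beyond [max(_, 1)] by a summable error
    ([almost_square_set]). A selective ultrafilter [U] contains sets of every
    prescribed sparseness ([selective_sparse]), so all these conditions, for
    uncountably many [x], are met along one filter
    ([selective_almost_square]).

    Hence for small [A] in [U] the formal sum of the [u i] over [A] is an
    element [F A] of the bidual, the weak* limit of its partial sums, and [h]
    is a weak* limit in the fourth dual of the [F A] as [A] shrinks along [U].
    Norms are weak* lower semicontinuous, so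
    [`|x + h| <= max(`|x|, 1)] for every [x].

    The norm of [h] does not drop below [1], and this is where the second pair
    of duals is needed. Let [f n] norm [u n], and let [mu] in the third dual be
    the weak* limit of the [f n] along [U]. For [n] in [A] the signed estimates
    at [x = 0] show that [f n] takes a value close to [1] on the sum over [A]
    ([coordinate_functional_lower_bound]); so [mu (F A)] is close to [1] for
    small [A], and [h mu >= 1].

    The lower bound [`|x + h| >= max(`|x|, 1)] is then formal: since
    [`|h - x|] obeys the same upper bound, the triangle inequality applied to
    [2 h = (x + h) + (h - x)] when [`|x| <= 1] and to
    [2 x = (x + h) - (h - x)] when [`|x| > 1] gives it.

    Norming functionals come from a form of the Hahn-Banach theorem in which
    linear functionals are found as the minimal sublinear ones
    ([minimal_sublinear_linear]). *)

Set Implicit Arguments.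
Unset Strict Implicit.
Unset Printing Implicit Defensive.

(** * Norming functionals *)

Section HahnBanach.
Context {R : realType}.

Lemma inf_le_add (A B C : set R) : A !=set0 -> B !=set0 -> has_lbound C ->
  (forall a b, A a -> B b -> exists2 c, C c & c <= a + b) ->
  inf C <= inf A + inf B.
Proof.
move=> A0 B0 Clb ABC; rewrite -lerBlDr; apply: lb_le_inf => // a Aa.
rewrite lerBlDr addrC -lerBlDr; apply: lb_le_inf => // b Bb.
have [c Cc cab] := ABC a b Aa Bb.
by rewrite lerBlDr addrC (le_trans _ cab)//; exact: ge_inf.
Qed.

Lemma inf_le_mul (A B : set R) (t : R) : 0 < t -> A !=set0 -> has_lbound B ->
  (forall a, A a -> exists2 b, B b & b <= t * a) -> inf B <= t * inf A.
Proof.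
move=> t0 A0 Blb AB; rewrite -ler_pdivrMl//; apply: lb_le_inf => // a Aa.
have [b Bb bta] := AB a Aa.
by rewrite ler_pdivrMl// (le_trans _ bta)//; exact: ge_inf.
Qed.

Variable X : normedModType R.

(** Only one inequality is asked of positive scalars, and nothing at [0]: this
    is what passes to infima, and [sublinearZ] recovers the equality. *)
Definition sublinear (q : X -> R) :=
  (forall x y, q (x + y) <= q x + q y) /\
  (forall t x, 0 < t -> q (t *: x) <= t * q x).

Lemma sublinear0 q : sublinear q -> q 0 = 0.
Proof.
move=> [qD qZ]; apply/eqP; rewrite eq_le; apply/andP; split.
  have := qZ 2^-1 0; rewrite scaler0 => /(_ ltac:(by rewrite invr_gt0)) ?; lra.
by have := qD 0 0; rewrite addr0 -{1}[q 0]addr0 lerD2l.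
Qed.

Lemma sublinearZ q t x : sublinear q -> 0 <= t -> q (t *: x) = t * q x.
Proof.
move=> sq; rewrite le_eqVlt => /orP[/eqP <-|t0].
  by rewrite scale0r mul0r sublinear0.
have [_ qZ] := sq; apply/eqP; rewrite eq_le qZ//= -ler_pdivlMl//.
by have := qZ t^-1 (t *: x); rewrite invr_gt0 scalerK ?gt_eqF//; apply.
Qed.

Lemma sublinear_ge q x : sublinear q -> - q (- x) <= q x.
Proof.
move=> sq; have [qD _] := sq; have := qD x (- x).
by rewrite subrr sublinear0// -lerBlDr sub0r.
Qed.

(** Zorn's lemma: the infimum of a chain of sublinear functions is sublinear,
    and it is finite because [p] bounds each member [q] from below through
    [- p (- x) <= - q (- x) <= q x]. *)
Lemma minimal_sublinear p : sublinear p ->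
  exists q, [/\ sublinear q, forall x, q x <= p x &
    forall q', sublinear q' -> (forall x, q' x <= q x) ->
      forall x, q x <= q' x].
Proof.
move=> sp; pose T := {q : X -> R | sublinear q /\ forall x, q x <= p x}.
pose le (s t : T) := `[< forall x, sval t x <= sval s x >].
have sT (s : T) : sublinear (sval s) by have [] := svalP s.
have lep (s : T) x : sval s x <= p x by have [_] := svalP s; apply.
have [||A Atot|[q [sq qp]] qmax] := @ZL_preorder T (exist _ p (conj sp (fun x => lexx (p x)))) le.
- by move=> t; apply/asboolP.
- by move=> r s t /asboolP rs /asboolP st; apply/asboolP => x;
    exact: le_trans (st x) (rs x).
- have [[s0 As0]|A0] := pselect (A !=set0); last first.
    exists (exist _ p (conj sp (fun x => lexx (p x)))) => s As.
    by exfalso; apply: A0; exists s.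
  pose V x := [set sval s x | s in A].
  have Vn x : V x !=set0 by exists (sval s0 x), s0.
  have Vlb x : has_lbound (V x).
    exists (- p (- x)) => _ [s As <-]; apply: (le_trans _ (sublinear_ge x (sT s))).
    by rewrite lerN2.
  have Vle s x : A s -> inf (V x) <= sval s x.
    by move=> As; apply: ge_inf => //; exists s.
  have sV : sublinear (fun x => inf (V x)).
    split=> [x y|t x t0].
      apply: inf_le_add => // _ _ [s As <-] [t At <-].
      have [/asboolP st|/asboolP ts] := Atot s t As At.
      (* of two members of the chain, the smaller one witnesses the bound *)
      + exists (sval t (x + y)); first by exists t.
        by apply: le_trans ((sT t).1 x y) _; rewrite lerD2r.
      + exists (sval s (x + y)); first by exists s.
        by apply: le_trans ((sT s).1 x y) _; rewrite lerD2l.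
    apply: inf_le_mul => // _ [s As <-].
    by exists (sval s (t *: x)); [exists s|exact: (sT s).2].
  have Vp x : inf (V x) <= p x by exact: le_trans (Vle s0 x As0) (lep _ _).
  exists (exist _ (fun x => inf (V x)) (conj sV Vp)) => s As; apply/asboolP => x /=.
  exact: Vle.
- exists q; split=> // q' sq' q'q.
  have q'p x : q' x <= p x by exact: le_trans (q'q x) (qp x).
  by have /(_ (asboolT q'q))/asboolP :=
    qmax (exist _ q' (conj sq' q'p)).
Qed.

(** The largest sublinear function below [q] whose value at [- y] is at most
    [- q y]. *)
Definition sublinear_slope (q : X -> R) (y x : X) : R :=
  inf [set q (x + t *: y) - t * q y | t in [set t | 0 <= t]].

Section Slope.
Variables (q : X -> R) (y : X).
Hypothesis sq : sublinear q.

Let V x := [set q (x + t *: y) - t * q y | t in [set t | 0 <= t]].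

Let Vn x : V x !=set0.
Proof. by exists (q (x + 0 *: y) - 0 * q y), 0 => /=. Qed.

Let Vlb x : has_lbound (V x).
Proof.
exists (- q (- x)) => _ [t /= t0 <-].
rewrite lerBrDr -(sublinearZ y sq t0) addrC.
have := sq.1 (x + t *: y) (- x); rewrite addrAC subrr add0r.
by rewrite lerBlDr.
Qed.

Lemma sublinear_slope_le x t : 0 <= t ->
  sublinear_slope q y x <= q (x + t *: y) - t * q y.
Proof. by move=> t0; apply: ge_inf; [exact: Vlb|exists t]. Qed.

Lemma sublinear_slope_sublinear : sublinear (sublinear_slope q y).
Proof.
split=> [x1 x2|s x s0].
  apply: inf_le_add; [exact: Vn|exact: Vn|exact: Vlb|].
  move=> _ _ [t1 /= t10 <-] [t2 /= t20 <-].
  exists (q (x1 + x2 + (t1 + t2) *: y) - (t1 + t2) * q y).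
    by exists (t1 + t2) => //=; exact: addr_ge0.
  have := sq.1 (x1 + t1 *: y) (x2 + t2 *: y).
  rewrite addrACA -scalerDl => ?; lra.
apply: inf_le_mul; [by []|exact: Vn|exact: Vlb|].
move=> _ [t /= t0 <-]; exists (q (s *: x + (s * t) *: y) - (s * t) * q y).
  by exists (s * t) => //=; rewrite mulr_ge0// ltW.
rewrite -scalerA -scalerDr mulrBr mulrA lerD2r.
exact: sq.2.
Qed.

End Slope.

(** By minimality [q] is below its own slopes, which at parameter [t = 1] says
    [q x <= q (x + y) - q y]: a minimal sublinear function is superadditive. *)
Lemma minimal_sublinear_linear q : sublinear q ->
  (forall q', sublinear q' -> (forall x, q' x <= q x) ->
    forall x, q x <= q' x) -> linear q.
Proof.
move=> sq qmin.
have qD x y : q (x + y) = q x + q y.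
  apply/eqP; rewrite eq_le sq.1/= -lerBrDr.
  have H z : sublinear_slope q y z <= q z.
    apply: le_trans (sublinear_slope_le y sq z (lexx 0)) _.
    by rewrite scale0r mul0r addr0 subr0.
  apply: le_trans (qmin _ (sublinear_slope_sublinear y sq) H x) _.
  by apply: le_trans (sublinear_slope_le y sq x ler01) _; rewrite scale1r mul1r.
have qN x : q (- x) = - q x.
  by apply/eqP; rewrite -addr_eq0 -qD addNr sublinear0.
move=> a x y; rewrite qD; congr (_ + _).
have [a0|/ltW a0] := leP 0 a; first exact: sublinearZ.
rewrite -[a in LHS]opprK scaleNr qN sublinearZ ?oppr_ge0//.
by rewrite mulNr opprK.
Qed.

Lemma linear_le_norm_continuous (f : X -> R) (C : R) : linear f ->
  (forall x, `|f x| <= C * `|x|) -> f \in @continuous_linear_form R X.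
Proof.
move=> L fC; rewrite inE; split=> //.
pose e : {linear X -> R} := HB.pack f (GRing.isLinear.Build R X R _ _ L).
apply: (@bounded_linear_continuous _ _ _ e); apply/linear_boundedP.
exists C; split=> [|r Cr x /=]; first exact: num_real.
by apply: le_trans (fC x) _; apply: ler_wpM2r => //; exact: ltW.
Qed.

(** Any minimal sublinear function below the slope of the norm in the direction
    [x] will do: at [- x] that slope is at most [- `|x|], which forces the
    value at [x] from below. *)
Lemma norming_functional (x : X) :
  exists f : dual_space X, `|f| <= 1 /\ f x = `|x|.
Proof.
pose p := sublinear_slope (fun x : X => `|x|) x.
have sn : sublinear (fun x : X => `|x|).
  split=> [a b|t a t0]; first exact: ler_normD.
  by rewrite normrZ gtr0_norm.
have [q [sq qp qmin]] := minimal_sublinear (sublinear_slope_sublinear x sn).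
have L := minimal_sublinear_linear sq qmin.
have qn y : q y <= `|y|.
  apply: le_trans (qp y) _.
  apply: le_trans (sublinear_slope_le x sn y (lexx 0)) _.
  by rewrite scale0r mul0r addr0 subr0.
have qN y : q (- y) = - q y.
  have := L (-1) y 0; rewrite scaleN1r addr0 => ->.
  by rewrite sublinear0 ?addr0 ?scaleN1r.
have qB y : `|q y| <= 1 * `|y|.
  by rewrite mul1r ler_norml qn andbT lerNl -qN -[leRHS]normrN qn.
exists (DualSpace (linear_le_norm_continuous L qB)); split.
  apply: dual_norm_le => y y1; apply: le_trans (qB y) _.
  by rewrite mul1r.
apply/eqP; rewrite eq_le qn/= -lerN2 -qN.
apply: le_trans (qp (- x)) _.
apply: le_trans (sublinear_slope_le x sn (- x) ler01) _.
by rewrite scale1r addNr normr0 mul1r sub0r.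
Qed.

Lemma bidual_embedding_norm (x : X) : `|bidual_embedding x| = `|x|.
Proof.
apply/eqP; rewrite eq_le; apply/andP; split.
  apply: dual_norm_le => f f1; apply: le_trans (dual_normP f x) _.
  by rewrite -[leRHS]mul1r ler_wpM2r.
have [f [f1 fx]] := norming_functional x.
have := dual_norm_ub (bidual_embedding x) f1.
by rewrite /= fx normr_id.
Qed.

Lemma bidual_embeddingN (x : X) : bidual_embedding (- x) = - bidual_embedding x.
Proof. by apply: val_inj; apply/funext => f /=; rewrite linearN. Qed.

End HahnBanach.

(** * Weak* limits along ultrafilters *)

Section WeakStarLimits.
Context {R : realType}.
Variables (Y : normedModType R) (I : Type) (V : set_system I).
Hypothesis VU : UltraFilter V.

(** The Banach-Alaoglu theorem in ultrafilter form: the values at each point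
    stay in a compact interval, and pointwise limits of linear forms with a
    common bound are bounded linear forms. *)
Lemma weak_star_ultralimit (f : I -> dual_space Y) (C : R) :
  (forall i, `|f i| <= C) ->
  exists g : dual_space Y, forall y, f i y @[i --> V] --> g y.
Proof.
move=> fC.
have fy i y : `|f i y| <= C * `|y|.
  by apply: le_trans (dual_normP (f i) y) _; apply: ler_wpM2r => //; exact: fC.
have lim_ex y : exists l : R, f i y @[i --> V] --> l.
  have : compact `[- (C * `|y|), C * `|y|]%classic by exact: segment_compact.
  rewrite compact_ultra => /(_ (f i y @[i --> V])).
  case=> [||l [_ fl]]; last by exists l.
    (* the image of the ultrafilter [V] is again maximal *)
    apply: Build_UltraFilter.
    move=> G GP VG; rewrite eqEsubset; split=> // S GS.
    have [//|VnS] := in_ultra_setVsetC ((fun i => f i y) @^-1` S) VU.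
    have GnS : G (~` S) by exact: VG.
    by have [z []] := filter_ex (filterI GS GnS).
  apply: (@filterE _ V) => i /=; rewrite in_itv/= -ler_norml; exact: fy.
have [g fg] := choice lim_ex.
have gL : linear g.
  move=> a x y.
  have : f i (a *: x + y) @[i --> V] --> a *: g x + g y.
    under eq_fun do rewrite linearP.
    apply: cvgD; last exact: fg.
    apply: cvgZl_tmp; exact: fg.
  by move/(cvg_lim (@Rhausdorff R)) <-; symmetry; exact: cvg_lim.
have gC y : `|g y| <= C * `|y|.
  have : `|f i y| @[i --> V] --> `|g y| by exact: cvg_norm.
  by move=> /cvgr_to_le; apply; apply: filterE => i; exact: fy.
by exists (DualSpace (linear_le_norm_continuous gL gC)).
Qed.

Lemma weak_star_limit_norm_le (f : I -> dual_space Y) (g : dual_space Y) (c : R) :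
  (forall y, f i y @[i --> V] --> g y) -> (\forall i \near V, `|f i| <= c) ->
  `|g| <= c.
Proof.
move=> fg fc; apply: dual_norm_le => y y1.
have : `|f i y| @[i --> V] --> `|g y| by exact: cvg_norm.
move=> /cvgr_to_le; apply; near=> i.
apply: le_trans (dual_norm_ub (f i) y1) _; near: i; exact: fc.
Unshelve. all: by end_near. Qed.

End WeakStarLimits.

Section BidualLimits.
Context {R : realType}.
Variables (Z : normedModType R) (I : Type) (V : set_system I).

(** Weak* convergence in the bidual of the canonical images of the [f i]. *)
Definition bidual_limit (f : I -> Z) (g : dual_space (dual_space Z)) :=
  forall phi : dual_space Z, phi (f i) @[i --> V] --> g phi.

Hypothesis VU : UltraFilter V.

Lemma bidual_limit_ex (f : I -> Z) (C : R) : (forall i, `|f i| <= C) ->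
  exists g, bidual_limit f g.
Proof.
move=> fC; apply: (@weak_star_ultralimit _ _ _ _ VU
  (fun i => bidual_embedding (f i)) C) => i.
by rewrite bidual_embedding_norm.
Qed.

Lemma bidual_limit_translate_norm_le (f : I -> Z) g (z : Z) (c : R) :
  bidual_limit f g -> (\forall i \near V, `|z + f i| <= c) ->
  `|bidual_embedding z + g| <= c.
Proof.
move=> fg fc; apply: (@weak_star_limit_norm_le _ _ _ _ VU
  (fun i => bidual_embedding (z + f i))).
  move=> phi; have -> : (bidual_embedding z + g) phi = phi z + g phi by [].
  rewrite /=; under eq_fun do rewrite linearD.
  by apply: cvgD; [exact: cvg_cst|exact: fg].
by apply: filterS fc => i; rewrite bidual_embedding_norm.
Qed.

End BidualLimits.

(** * Sparse sets in a selective ultrafilter *)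

Lemma fast_growing_majorant (f : nat -> nat) : exists g : nat -> nat,
  [/\ {homo g : m n / (m <= n)%N}, forall m, (m < g m)%N &
      forall m, (f m <= g m)%N].
Proof.
pose g m := (\sum_(i < m.+1) (f i).+1)%N.
have gS m : g m.+1 = (g m + (f m.+1).+1)%N by rewrite /g big_ord_recr.
have g0 : g 0%N = (f 0%N).+1 by rewrite /g big_ord1.
exists g; split.
- apply: homo_leq => [//|? ? ?|i]; first exact: leq_trans.
  by rewrite gS leq_addr.
- by elim=> [|m IH]; rewrite ?g0// gS; lia.
- by case=> [|m]; rewrite ?g0// gS; lia.
Qed.

Section Selective.
Variable U : set_system nat.
Hypothesis Usel : selective_ultrafilter U.

Let UU : UltraFilter U. Proof. by case: Usel. Qed.
#[local] Existing Instance UU.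

Lemma selective_tail N : U [set n | (N <= n)%N].
Proof.
case: Usel => _ Unp _; elim: N => [|N IH].
  by apply: filterS filterT => n _ /=.
have [UN|UN] := in_ultra_setVsetC [set N] UU.
  exfalso; apply: (Unp N); apply/seteqP; split=> S.
    move=> US; apply/principal_filterP.
    by have [n [SN <-]] := filter_ex (filterI US UN).
  by move=> /principal_filterP SN; apply: filterS UN => n ->.
apply: filterS (filterI IH UN) => n [/= Nn /eqP nN].
by rewrite ltn_neqAle eq_sym nN.
Qed.

(** Cut [nat] into intervals [[a k, a k.+1)] along which [f] is overtaken, and
    let [S] in [U] meet each interval once. Points of consecutive intervals may
    still be close to each other, so only the intervals whose index has a fixed
    parity are kept, the parity being chosen by [U]; then a whole interval lies
    between two points. *)
Lemma selective_sparse (f : nat -> nat) : exists2 A, U A &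
  forall m n, A m -> A n -> (m < n)%N -> (f m <= n)%N.
Proof.
have [g [gmon gm fg]] := fast_growing_majorant f.
pose a k := iter k g 0%N.
have aS k : (a k < a k.+1)%N by exact: gm.
have amon : {homo a : j k / (j <= k)%N}.
  by apply: homo_leq => [//|? ? ?|i]; [exact: leq_trans|exact: ltnW].
pose J k := [set n | (a k <= n < a k.+1)%N].
have Jex n : exists k, J k n.
  elim: n => [|n [k /andP[kn nk]]]; first by exists 0%N; rewrite /J/= gm.
  have [nk'|nk'] := ltnP n.+1 (a k.+1).
    by exists k; rewrite /J/= nk' (leq_trans kn).
  exists k.+1; rewrite /J/= nk'/=; apply: leq_ltn_trans (aS k.+1).
  exact: nk.
have Jle j k m n : J j m -> J k n -> (m <= n)%N -> (j <= k)%N.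
  move=> /andP[jm mj] /andP[kn nk] mn; rewrite leqNgt; apply/negP => kj.
  by have := amon _ _ kj; lia.
(* [b n] is the index of the interval that contains [n] *)
have [b bJ] := choice Jex.
have [//||S US SJ] := (let: And3 _ _ P := Usel in P) J.
- split=> [|j k _ _ [n [jn kn]]|k _].
  + by apply/seteqP; split=> // n _; have [k kn] := Jex n; exists k.
  + by apply/eqP; rewrite eqn_leq (Jle j k n n)// (Jle k j n n).
  + by exists (a k); rewrite /J/= leqnn aS.
- move=> k UJ; have [n []] := filter_ex (filterI UJ (selective_tail (a k.+1))).
  by move=> /andP[_ +] /=; rewrite ltnNge => /negP.
have [E UE Epar] : exists2 E, U E &
    forall m n, E m -> E n -> odd (b m) = odd (b n).
  have [UE|UE] := in_ultra_setVsetC [set n | odd (b n)] UU.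
    by exists [set n | odd (b n)] => // m n /= -> ->.
  by exists (~` [set n | odd (b n)]) => // m n /= /negP/negbTE -> /negP/negbTE ->.
exists (S `&` E) => [|m n [Sm Em] [Sn En] mn]; first exact: filterI.
have bmn : (b m <= b n)%N by apply: Jle (bJ m) (bJ n) (ltnW mn).
have bneq : b m <> b n.
  move=> bE; have [k Jk] := SJ (b m).
  have : (S `&` J (b m)) m by [].
  have : (S `&` J (b m)) n by split=> //; rewrite bE.
  by rewrite Jk /= => nk mk; move: mn; rewrite nk mk ltnn.
have b2 : ((b m).+2 <= b n)%N.
  have := Epar m n Em En; move: bmn bneq; clear; lia.
have /andP[_ mlt] := bJ m; have /andP[nge _] := bJ n.
apply: leq_trans (fg m) _; apply: leq_trans nge; apply: leq_trans (amon _ _ b2).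
by rewrite /a iterS; apply: gmon; exact: ltnW.
Qed.

End Selective.

(** * Signed sums over sparse sets *)

Section SignedSums.
Context {R : realType} {X : normedModType R}.
Variable u : nat -> X.

Definition sign_pattern (c : nat -> R) :=
  forall i, [\/ c i = 0, c i = 1 | c i = -1].

Definition partial_sum (c : nat -> R) (N : nat) : X := \sum_(i < N) c i *: u i.

Lemma partial_sumS c N : partial_sum c N.+1 = partial_sum c N + c N *: u N.
Proof. by rewrite /partial_sum big_ord_recr. Qed.

Lemma partial_sum0 c : partial_sum c 0 = 0.
Proof. by rewrite /partial_sum big_ord0. Qed.

Hypothesis u_asq :
  forall x : X, `|x + u n| @[n --> \oo] --> Num.max `|x| 1.

Lemma near_signed_step (x : X) (e : R) : 0 < e ->
  \forall n \near \oo, forall s : R, s = 1 \/ s = -1 ->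
    `|x + s *: u n| <= Num.max `|x| 1 + e.
Proof.
move=> e0; near=> n => s [->|->].
  rewrite scale1r; near: n.
  by have /cvgr_le := @u_asq x; apply; rewrite ltrDl.
rewrite scaleN1r -normrN opprB addrC -(normrN x); near: n.
by have /cvgr_le := @u_asq (- x); apply; rewrite ltrDl.
Unshelve. all: by end_near. Qed.

(** A single threshold serves all signed sums of the first [m] vectors, since
    there are finitely many; the induction on [m] moves the last term of the
    sum into the base point [x]. *)
Lemma near_signed_sum_step m (x : X) (e : R) : 0 < e ->
  \forall n \near \oo, forall (c : nat -> R) (s : R),
    sign_pattern c -> s = 1 \/ s = -1 ->
    `|x + partial_sum c m + s *: u n| <=
    Num.max `|x + partial_sum c m| 1 + e.
Proof.
move=> e0; elim: m x => [|m IH] x.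
  near=> n => c s _ sE; rewrite partial_sum0 addr0.
  move: s sE; near: n; exact: near_signed_step.
near=> n => c s cs sE; rewrite partial_sumS (addrC (partial_sum c m)) addrA.
have [->|->|->] := cs m.
- by rewrite scale0r addr0; move: c s cs sE; near: n; exact: IH.
- by rewrite scale1r; move: c s cs sE; near: n; exact: IH.
- by rewrite scaleN1r; move: c s cs sE; near: n; exact: IH.
Unshelve. all: by end_near. Qed.

Definition almost_square_set (x : X) (e : R) : set (set nat) :=
  [set A | forall c : nat -> R, sign_pattern c ->
     (forall i, ~ A i -> c i = 0) ->
     forall N, `|x + partial_sum c N| <= Num.max `|x| 1 + e].

(** With errors [e / 2 ^+ m.+1] for adding a term to a sum of length [m], the
    total error is below [e]. *)
Lemma selective_almost_square (U : set_system nat) (x : X) (e : R) :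
  selective_ultrafilter U -> 0 < e ->
  exists2 A, U A & almost_square_set x e A.
Proof.
move=> Usel e0; have UU : UltraFilter U by case: Usel.
have /choice[g gP] : forall m, exists N, forall n, (N <= n)%N ->
    forall (c : nat -> R) (s : R), sign_pattern c -> s = 1 \/ s = -1 ->
    `|x + partial_sum c m + s *: u n| <=
    Num.max `|x + partial_sum c m| 1 + e / 2 ^+ m.+1.
  move=> m.
  have em : 0 < e / 2 ^+ m.+1 by rewrite divr_gt0// exprn_gt0.
  by have [N _ NP] := near_signed_sum_step m x em; exists N.
have [A UA Asparse] := selective_sparse Usel (fun m => g m.+1).
exists (A `&` [set n | (g 0 <= n)%N]).
  by apply: filterI => //; exact: selective_tail.
move=> c cs cA; pose M := Num.max `|x| 1.
(* [m] is one more than the last index below [N] with a nonzero coefficient,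
   or [0] if there is none: the error made so far, and the threshold for the
   next term, depend on [m] and not on [N]. *)
suff H N : exists m, [/\ (m <= N)%N, partial_sum c N = partial_sum c m,
    m = 0%N \/ A m.-1 &
    Num.max `|x + partial_sum c m| 1 <= M + e * (1 - 2^-1 ^+ m)].
  move=> N; have [m [_ -> _ H1]] := H N.
  have : `|x + partial_sum c m| <= M + e * (1 - 2^-1 ^+ m).
    by apply: le_trans H1; rewrite le_max lexx.
  by move=> /le_trans; apply; rewrite lerD2l ger_pMr// gerBl exprn_ge0.
elim: N => [|N [m [mN cN Am IH]]].
  exists 0%N; split=> //; first by left.
  by rewrite partial_sum0 addr0 expr0 subrr mulr0 addr0.
have [c0|/eqP cN0] := eqVneq (c N) 0.
  by exists m; split=> //; [exact: leqW|rewrite partial_sumS c0 scale0r addr0].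
have [AN gN] : (A `&` [set n | (g 0 <= n)%N]) N by apply: contrapT => /cA.
exists N.+1; split=> //; first by right.
have gmN : (g m <= N)%N.
  case: m mN Am {cN IH} => [//|m] mN [//|/= Am].
  exact: Asparse.
rewrite partial_sumS cN addrA.
have cNs : c N = 1 \/ c N = -1 by case: (cs N) => ?; [by []|left|right].
have step := gP m N gmN c (c N) cs cNs.
(* it remains to compare the error at [m.+1] with the one allowed at [N.+1] *)
have pow : (2^-1 : R) ^+ N <= 2^-1 ^+ m.
  by rewrite ler_wiXn2l// ?invr_ge0// invf_le1// ler1n.
have eN : e * 2^-1 ^+ N <= e * 2^-1 ^+ m by rewrite ler_wpM2l// ltW.
have e1 : e / 2 ^+ m.+1 = e * 2^-1 ^+ m / 2.
  by rewrite -exprVn exprS; field.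
have e2 : e * 2^-1 ^+ N.+1 = e * 2^-1 ^+ N / 2 by rewrite exprS; field.
move: step IH; rewrite e1 mulrBr mulrBr e2 => step IH.
rewrite ge_max; apply/andP; split; first lra.
have M1 : 1 <= M by rewrite /M le_max lexx orbT.
have : e * 2^-1 ^+ N <= e.
  rewrite ger_pMr// exprn_ile1// ?invr_ge0// invf_le1// ler1n//.
lra.
Qed.

End SignedSums.

(** * The functional in the fourth dual *)

(** [U] itself is directed downwards by inclusion, so there are ultrafilters
    along which a variable element of [U] shrinks below any given one. *)
Lemma subset_ultrafilter (U : set_system nat) : ProperFilter U ->
  exists2 V : set_system (set nat), UltraFilter V &
    forall A, U A -> \forall B \near V, U B /\ B `<=` A.
Proof.
move=> UP.
have FP : ProperFilter (filter_from U (fun A => [set B | U B /\ B `<=` A])).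
  apply: filter_from_proper => [|A UA]; last first.
    by exists A; split.
  apply: filter_from_filter => [|A B UA UB]; first by exists setT; exact: filterT.
  exists (A `&` B); first exact: filterI.
  by move=> C [UC CAB]; split; split=> // n /CAB[].
have [V [VU FV]] := ultraFilterLemma FP.
by exists V => // A UA; apply: FV; exists A.
Qed.

Section Flip.
Context {R : realType} {X : normedModType R}.
Variable u : nat -> X.

Lemma indic_sign_pattern (B : set nat) : sign_pattern (\1_B : nat -> R).
Proof.
by move=> i; rewrite indicE; case: (i \in B); [exact: Or32|exact: Or31].
Qed.

(** Flipping all signs but the one at [n] changes the sum over [B] into [c] with
    [\1_B + c] equal to [2] at [n] and [0] elsewhere below [N]; as [f] is at
    most [1 + e] on the flipped sum, it is at least [2 - (1 + e)] on the
    original one. *)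
Lemma coordinate_functional_lower_bound (e : R) (A B : set nat) (n N : nat)
    (f : dual_space X) : almost_square_set u 0 e A -> B `<=` A -> B n ->
  (n < N)%N -> `|f| <= 1 -> f (u n) = 1 ->
  1 - e <= f (partial_sum u \1_B N).
Proof.
move=> Ae BA Bn nN f1 fn.
pose c i : R := if i == n then 1 else - \1_B i.
have cs : sign_pattern c.
  move=> i; rewrite /c; case: eqP => _; first exact: Or32.
  rewrite indicE; case: (i \in B); first exact: Or33.
  by rewrite oppr0; exact: Or31.
have cA i : ~ A i -> c i = 0.
  move=> nAi; rewrite /c; case: eqP => [iE|_].
    by exfalso; apply: nAi; rewrite iE; exact: BA.
  by rewrite indicE memNset ?oppr0// => /BA.
have := Ae c cs cA N; rewrite add0r normr0 max_r ?ler01// => cN.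
have sumE : partial_sum u \1_B N + partial_sum u c N = 2 *: u n.
  rewrite /partial_sum -big_split/= (bigD1 (Ordinal nN))//= big1 ?addr0.
    by rewrite -scalerDl /c eqxx indicE mem_set.
  move=> i iN; rewrite -scalerDl /c ifN ?subrr ?scale0r//.
have fc : f (partial_sum u c N) <= 1 + e.
  apply: le_trans (ler_norm _) _; apply: le_trans (dual_normP f _) _.
  by apply: le_trans cN; rewrite -[leRHS]mul1r; apply: ler_wpM2r.
have : f (partial_sum u \1_B N) + f (partial_sum u c N) = 2.
  by rewrite -linearD sumE linearZ/= fn; exact: mulr1.
move: fc; lra.
Qed.

End Flip.

Theorem theorem1p5 (R : realType) (X : completeNormedModType R)
    (U : set_system nat) :
  sequentially_ASQ X ->
  selective_ultrafilter U ->
  exists h : fourth_dual X,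
    `|h| = 1 /\
    forall x : X, `|fourth_dual_embedding x + h| = Num.max `|x| 1.
Proof.
move=> [u u1 u_asq] Usel; have UU : UltraFilter U by case: Usel.
have good x e := @selective_almost_square R X u u_asq U x e Usel.
(* [A0] bounds the partial sums over all of its subsets at once *)
have [A0 UA0 A0good] := good 0 1 ltr01.
pose s (A : set nat) N := partial_sum u (\1_(A `&` A0) : nat -> R) N.
have indA0 (A B : set nat) : A `<=` B -> forall i, ~ B i -> \1_(A `&` A0) i = 0 :> R.
  by move=> AB i nBi; rewrite indicE memNset// => -[/AB].
have s2 A N : `|s A N| <= 2.
  have := A0good _ (@indic_sign_pattern R (A `&` A0)) _ N.
  rewrite add0r normr0 max_r ?ler01//; apply => i nA0.
  by rewrite indicE memNset// => -[].
have /choice[F sF] A : exists g, bidual_limit U (s A) g.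
  exact: bidual_limit_ex (s2 A).
have F2 A : `|F A| <= 2.
  have := bidual_limit_translate_norm_le (z := 0) (c := 2) UU (sF A).
  have -> : bidual_embedding (0 : X) = 0.
    by apply/eqP; rewrite -normr_eq0 bidual_embedding_norm normr0.
  by rewrite add0r; apply; apply: filterE => N; rewrite add0r.
have [V VU VP] := subset_ultrafilter (ultra_proper (F := U)).
have [h hP] := bidual_limit_ex VU F2.
have upper x : `|fourth_dual_embedding x + h| <= Num.max `|x| 1.
  apply/ler_addgt0Pr => e e0; have [A UA Agood] := good x e e0.
  apply: bidual_limit_translate_norm_le hP _.
  apply: filterS (VP A UA) => B [_ BA].
  apply: bidual_limit_translate_norm_le (sF B) _.
  apply: filterE => N; apply: Agood; first exact: indic_sign_pattern.
  exact: indA0.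
have emb_norm x : `|fourth_dual_embedding x| = `|x|.
  by rewrite /fourth_dual_embedding !bidual_embedding_norm.
have embN x : fourth_dual_embedding (- x) = - fourth_dual_embedding x.
  by rewrite /fourth_dual_embedding !bidual_embeddingN.
have h_ge1 : 1 <= `|h|.
  have /choice[f fP] n := norming_functional (u n).
  have f1 n : `|f n| <= 1 by have [] := fP n.
  have fn n : f n (u n) = 1 by have [_ ->] := fP n.
  have [mu muP] := bidual_limit_ex UU f1.
  have mu1 : `|mu| <= 1.
    apply: (@weak_star_limit_norm_le _ _ _ _ UU (fun n => bidual_embedding (f n))) => //.
    by apply: filterE => n; rewrite bidual_embedding_norm.
  have hmu : 1 <= h mu.
    apply/ler_addgt0Pr => e e0; rewrite -lerBlDr.
    have [A UA Agood] := good 0 e e0.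
    have /cvgr_to_ge := hP mu; apply.
    apply: filterS (VP A UA) => B [UB BA].
    have /cvgr_to_ge := muP (F B); apply.
    apply: filterS (filterI UB UA0) => n Bn.
    have /cvgr_to_ge := sF B (f n); apply.
    apply: filterS (selective_tail Usel n.+1) => N nN.
    by apply: coordinate_functional_lower_bound Agood _ Bn nN (f1 n) (fn n) => i [/BA].
  apply: le_trans hmu _; apply: le_trans (ler_norm _) _.
  by apply: dual_norm_ub.
have h1 : `|h| = 1.
  apply/eqP; rewrite eq_le h_ge1 andbT.
  have := upper 0; rewrite normr0 max_r ?ler01//.
  have -> : fourth_dual_embedding (0 : X) = 0.
    by apply/eqP; rewrite -normr_eq0 emb_norm normr0.
  by rewrite add0r.
exists h; split=> // x; apply/eqP; rewrite eq_le upper/=.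
have upperN : `|h - fourth_dual_embedding x| <= Num.max `|x| 1.
  by have := upper (- x); rewrite embN normrN addrC.
have normD2 (Z : normedModType R) (z : Z) : `|z + z| = 2 * `|z|.
  by rewrite -mulr2n normrMn mulr_natl.
move: upperN; have [x1|x1] := leP `|x| 1 => upperN.
  have : `|h + h| <= `|fourth_dual_embedding x + h| + `|h - fourth_dual_embedding x|.
    by apply: le_trans (ler_normD _ _); rewrite [X in _ <= `|X|]addrC addrA subrK.
  rewrite normD2 h1; lra.
have : `|fourth_dual_embedding x + fourth_dual_embedding x| <=
    `|fourth_dual_embedding x + h| + `|h - fourth_dual_embedding x|.
  rewrite -(normrN (h - _)) (le_trans _ (ler_normD _ _))// opprB addrACA.
  by rewrite subrr addr0.
rewrite normD2 emb_norm; lra.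
Qed.
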